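(* Let $m\ge 1$ and $n\ge m+3$ be integers. For every partition $S_1,\dots,S_{m+1}$ of $V_n=\{1,\dots,n\}$ into $m+1$ non-empty parts, the $m$-partition hemi-metric $\alpha(S_1,\dots,S_{m+1})$ generates an extreme ray of the cone $HMET^m_n$ of $m$-hemi-metrics.
   Context: Let $\binom{V_n}{m+1}$ be the set of $(m+1)$-subsets of $V_n$. A totally symmetric map $d:V_n^{m+1}\to\mathbb{R}$ vanishing whenever its arguments are not pairwise distinct is identified with a vector $d\in\mathbb{R}^{\binom{V_n}{m+1}}$. The cone $HMET^m_n\subset\mathbb{R}^{\binom{V_n}{m+1}}$ is the set of all $d$ satisfying $d(A)\ge 0$ for every $(m+1)$-subset $A\subset V_n$ and the $m$-simplex inequalities $$d(T\setminus\{i\})\le \sum_{k\in T\setminus\{i\}} d(T\setminus\{k\})$$ for every $(m+2)$-subset $T\subset V_n$ and every $i\in T$. An extreme ray of a polyhedral cone is a face of dimension $1$. Given an unordered partition $S_1,\dots,S_{m+1}$ of $V_n$ into $m+1$ non-empty parts, the $m$-partition hemi-metric $\alpha(S_1,\dots,S_{m+1})$ is the function on $(m+1)$-subsets of $V_n$ equal to $1$ on $\{x_1,\dots,x_{m+1}\}$ if (after renumbering) $x_1\in S_1,\dots,x_{m+1}\in S_{m+1}$, i.e. if the subset meets every part in exactly one element, and equal to $0$ otherwise. *)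

(* Defs.v *)
From mathcomp Require Import all_boot all_order all_algebra.
From mathcomp Require Import boolp classical_sets reals.

Set Implicit Arguments.
Unset Strict Implicit.
Unset Printing Implicit Defensive.

Import Order.TTheory GRing.Theory Num.Theory.
Local Open Scope ring_scope.
Local Open Scope classical_set_scope.

Section Faces.
Variables (R : realType) (V : vectType R).
Implicit Types (C F : set V) (v : V) (k : nat).

(* The half-spaces considered are the homogeneous ones, so every face of a
   cone contains the origin; [f = 0] gives the improper face [C]. *)
Definition cone_face C F : Prop :=
  exists f : 'Hom(V, R^o),
    (forall x, C x -> 0 <= f x) /\ F = C `&` [set x | f x = 0].

(* The dimension of a set through the origin (such as a face of a cone) is the
   dimension of its linear span, the least subspace containing it. *)
Definition has_dim F k : Prop :=
  exists U : {vspace V},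
    [/\ forall x, F x -> x \in U,
        forall W : {vspace V}, (forall x, F x -> x \in W) -> (U <= W)%VS
      & \dim U = k].

Definition extreme_ray C F : Prop := cone_face C F /\ has_dim F 1%N.

Definition ray v : set V := [set x | exists2 a : R, 0 <= a & x = a *: v].

Definition generates_extreme_ray C v : Prop := extreme_ray C (ray v).

End Faces.

Notation ksubset n k := {A : {set 'I_n} | #|A| == k}.

(* [R^o] is [R] seen as a vector space over itself, which makes this type a
   [vectType R]. *)
Notation hvec R m n := {ffun ksubset n m.+1 -> R^o}.

Section HemiMetrics.
Variables (R : realType) (m n : nat).

(* [d] extended by the junk value 0 to subsets of size other than [m.+1]; this
   avoids carrying a cardinality proof for [T :\ i]. *)
Definition heval (d : hvec R m n) (A : {set 'I_n}) : R :=
  if insub A is Some a then d a else 0.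

Definition HMET : set (hvec R m n) :=
  [set d | (forall A : {set 'I_n}, #|A| = m.+1 -> 0 <= heval d A) /\
           (forall (T : {set 'I_n}) (i : 'I_n), #|T| = m.+2 -> i \in T ->
              heval d (T :\ i)%SET
                <= \sum_(k in (T :\ i)%SET) heval d (T :\ k)%SET)].

Definition partition_hemimetric (S : {set {set 'I_n}}) : hvec R m n :=
  [ffun A : ksubset n m.+1 =>
     if [forall B in S, #|(val A :&: B)%SET| == 1%N] then 1 else 0].

End HemiMetrics.

(* Main.v *)
Require Import Defs.
From HB Require Import structures.
From mathcomp Require Import all_boot all_order all_algebra.
From mathcomp Require Import boolp classical_sets reals.

(** Call a set meeting every part of [S] in exactly one point a transversal;
    the partition hemi-metric [alpha] is the indicator of the transversals.
    A vector [v] of a polyhedral cone spans an extreme ray as soon as the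
    inequalities that are tight at [v] force a point of the cone to be a
    nonnegative multiple of [v]: the sum of the tight functionals is nonnegative
    on the cone, and it vanishes exactly where all of them do
    ([polyhedral_extreme_ray]).

    For [alpha], tightness of the inequalities [0 <= d A] says that [d] vanishes
    off the transversals.  Now let [A] be a transversal, [x \in A], and [y != x]
    in the part of [x].  Among the facets of the simplex [T = y |: A], those
    keeping both [x] and [y] meet that part twice, so [T :\ y = A] and [T :\ x]
    are the only transversals ([transversal_exchange],
    [transversal_facet_ends]).  Hence the simplex inequality of [T] at [y] is
    [1 <= 1] for [alpha], and its tightness for [d] reads [d A = d (T :\ x)]:
    exchanging [x] for [y] does not change [d].  Exchanges inside parts connect
    any two transversals ([transversal_connect]), so [d] is a constant multiple
    of [alpha].  The same exchange shows that [alpha] satisfies the simplex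
    inequalities: a transversal facet always comes with a second one. *)

Set Implicit Arguments.
Unset Strict Implicit.
Unset Printing Implicit Defensive.

Import Order.TTheory GRing.Theory Num.Theory.
Local Open Scope ring_scope.

(** * Extreme rays of polyhedral cones *)

Section PolyhedralCone.
Variables (R : realType) (V : vectType R) (J : finType) (P : pred J).
Variable g : J -> 'Hom(V, R^o).

Definition polyhedral_cone : set V :=
  [set x : V | forall j, P j -> 0 <= g j x :> R]%classic.

(** The sum of the functionals tight at [v] is a supporting functional whose
    zero set in the cone is the smallest face containing [v]; the last
    hypothesis says that this face is no more than the ray of [v]. *)
Lemma polyhedral_extreme_ray (v : V) :
    polyhedral_cone v -> v != 0 ->
    (forall x, polyhedral_cone x ->
       (forall j, P j -> g j v = 0 -> g j x = 0) ->
       exists2 a : R, 0 <= a & x = a *: v) ->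
  generates_extreme_ray polyhedral_cone v.
Proof.
move=> Cv v0 tight_ray.
pose tight j := P j && (g j v == 0).
have fE x : (\sum_(j | tight j) g j) x = \sum_(j | tight j) g j x.
  by rewrite sum_lfunE.
split; last first.
  exists <[v]>%VS; split.
  - by move=> x [a _ ->]; rewrite memvZ ?memv_line.
  - move=> W rayW; rewrite -memvE; apply: rayW.
    by exists 1; rewrite ?ler01 ?scale1r.
  - by rewrite dim_vline v0.
exists (\sum_(j | tight j) g j); split=> [x Cx|].
  by rewrite fE; apply: sumr_ge0 => j /andP[/Cx].
apply/seteqP; split=> x /=.
  move=> [a a0 ->]; split=> [j Pj|].
    by rewrite linearZ; apply: mulr_ge0 => //; apply: Cv.
  rewrite fE big1 // => j /andP[_ /eqP gv0].
  by rewrite linearZ /= gv0 scaler0.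
move=> [Cx]; rewrite fE => sum0.
apply: tight_ray => // j Pj gv0.
have ge0 i : tight i -> 0 <= g i x :> R by move=> /andP[/Cx].
have /= := @psumr_eq0P R J tight (fun i => g i x) ge0 sum0.
by apply; rewrite /tight Pj gv0 eqxx.
Qed.

End PolyhedralCone.

(** * Transversals of a partition and exchanges *)

Section Transversals.
Variables (T : finType) (S : {set {set T}}).
Hypothesis hS : finset.partition S [set: T].
Implicit Types (A B : {set T}) (x y z : T).

Definition transversal_set A := [forall B in S, #|A :&: B| == 1%N].

Lemma card_transversal_set A : transversal_set A -> #|A| = #|S|.
Proof.
move=> trA; apply: (@card_transversal _ A S [set: T]).
by rewrite /is_transversal hS finset.subsetT.
Qed.

Lemma transversal_set_exists : exists A, transversal_set A.
Proof.
by exists (transversal S [set: T]); have /and3P[] := transversalP hS.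
Qed.

Lemma transversal_uniq A B x y :
  transversal_set A -> B \in S -> x \in A -> x \in B -> y \in A -> y \in B ->
  x = y.
Proof.
move=> /forall_inP trA /trA /cards1P[z ABz] xA xB yA yB.
have : x \in A :&: B by rewrite inE xA.
have : y \in A :&: B by rewrite inE yA.
by rewrite ABz !inE => /eqP -> /eqP ->.
Qed.

Lemma transversal_pick A B :
  transversal_set A -> B \in S -> exists2 x, x \in A & x \in B.
Proof.
move=> /forall_inP trA /trA /cards1P[z ABz].
have : z \in A :&: B by rewrite ABz set11.
by rewrite inE => /andP[]; exists z.
Qed.

Lemma part_of x : exists2 B, B \in S & x \in B.
Proof.
have /bigcupP[B BS xB] : x \in finset.cover S.
  by rewrite (cover_partition hS) inE.
by exists B.
Qed.

Lemma part_uniq B C x : B \in S -> C \in S -> x \in B -> x \in C -> B = C.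
Proof.
have /and3P[_ tiS _] := hS => BS CS xB xC.
by rewrite -(def_pblock tiS BS xB) (def_pblock tiS CS xC).
Qed.

Lemma transversal_exchange A B x y :
  transversal_set A -> B \in S -> x \in A -> x \in B -> y \in B ->
  transversal_set (y |: A :\ x).
Proof.
move=> trA BS xA xB yB; apply/forall_inP => C CS.
have [->|CB] := eqVneq C B.
  apply/cards1P; exists y; apply/setP => z; rewrite !inE.
  have [->|_] := eqVneq z y; first by rewrite yB.
  rewrite /=; apply/negP => /andP[/andP[zx zA] zB].
  by move: zx; rewrite (transversal_uniq trA BS zA zB xA xB) eqxx.
rewrite (_ : _ :&: C = A :&: C); first exact: (forall_inP trA).
apply/setP => z; rewrite !inE.
have [->|_] := eqVneq z y; last first.
  have [->|//] := eqVneq z x; rewrite xA /=.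
  by apply/esym/negP => xC; rewrite (part_uniq CS BS xC xB) eqxx in CB.
have -> : (y \in C) = false; last by rewrite !andbF.
by apply/negP => yC; rewrite (part_uniq CS BS yC yB) eqxx in CB.
Qed.

(** A facet that keeps both [x] and [y] meets their common part twice. *)
Lemma transversal_facet_ends (U B : {set T}) x y k :
  B \in S -> x \in B -> y \in B -> x != y -> x \in U -> y \in U ->
  transversal_set (U :\ k) -> (k == x) || (k == y).
Proof.
move=> BS xB yB xy xU yU trU; apply/norP => -[kx ky].
move: xy; rewrite (@transversal_uniq (U :\ k) B x y) ?eqxx // !inE.
  by rewrite eq_sym kx.
by rewrite eq_sym ky.
Qed.

(** Each exchange of a point of [A] outside [A'] for the point of [A'] in the
    same part brings [A] one step closer to [A']. *)
Lemma transversal_connect (X : Type) (h : {set T} -> X) :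
    (forall A B x y, transversal_set A -> B \in S -> x \in A ->
       x \in B -> y \in B -> x != y -> h A = h (y |: A :\ x)) ->
  forall A A', transversal_set A -> transversal_set A' -> h A = h A'.
Proof.
move=> hexch A A'; have [k] := ubnP #|A :\: A'|.
elim: k A => // k IH A ltk trA trA'.
have [AA'|/subsetPn[x xA xA']] := boolP (A \subset A').
  suff -> : A = A' by [].
  apply/eqP; rewrite eqEcard AA' (card_transversal_set trA).
  by rewrite (card_transversal_set trA') leqnn.
have [B BS xB] := part_of x.
have [y yA' yB] := transversal_pick trA' BS.
have xy : x != y by apply: contraNneq xA' => ->.
rewrite (hexch A B x y) //; apply: IH => //.
  rewrite -ltnS; apply: leq_trans ltk; rewrite ltnS.
  apply: proper_card; apply/properP; split.
    apply/fintype.subsetP => z; rewrite !inE => /andP[zA'].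
    have [zy|_] := eqVneq z y; first by rewrite zy yA' in zA'.
    by rewrite zA' => /andP[].
  exists x; first by rewrite inE xA xA'.
  by rewrite !inE eqxx (negPf xy) andbF.
exact: transversal_exchange trA BS xA xB yB.
Qed.

End Transversals.

(** * The hemi-metric cone as a polyhedral cone *)

Section HemiMetricCone.
Variables (R : realType) (m n : nat).
Implicit Types (d : hvec R m n) (A U : {set 'I_n}).

Definition hcoord A d : R^o := heval d A.

Lemma hcoord_is_linear A : linear (hcoord A).
Proof.
move=> a d e; rewrite /hcoord /heval.
by case: insub => [u|]; rewrite ?ffunE ?scaler0 ?addr0.
Qed.

HB.instance Definition _ A :=
  GRing.isLinear.Build R (hvec R m n) R^o _ (hcoord A) (hcoord_is_linear A).

Lemma heval_val d (u : ksubset n m.+1) : heval d (val u) = d u.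
Proof. by rewrite /heval valK. Qed.

Definition simplex_slack U (i : 'I_n) : 'Hom(hvec R m n, R^o) :=
  \sum_(k in U :\ i) linfun (hcoord (U :\ k)) - linfun (hcoord (U :\ i)).

Lemma simplex_slackE U i d :
  simplex_slack U i d
    = \sum_(k in U :\ i) heval d (U :\ k) - heval d (U :\ i) :> R.
Proof.
rewrite /simplex_slack add_lfunE opp_lfunE sum_lfunE lfunE /=.
by under eq_bigr => k _ do rewrite lfunE.
Qed.

(** Nonnegativity and simplex inequalities are indexed together, so that the
    cone is cut out by one finite family of functionals. *)
Definition hmet_index : finType :=
  ({set 'I_n} + {set 'I_n} * 'I_n)%type.

Definition hmet_valid (j : hmet_index) : bool :=
  match j with
  | inl A => #|A| == m.+1
  | inr (U, i) => (#|U| == m.+2) && (i \in U)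
  end.

Definition hmet_functional (j : hmet_index) : 'Hom(hvec R m n, R^o) :=
  match j with
  | inl A => linfun (hcoord A)
  | inr (U, i) => simplex_slack U i
  end.

Lemma HMET_polyhedral :
  @HMET R m n = polyhedral_cone hmet_valid hmet_functional.
Proof.
apply/seteqP; split=> d /=.
  move=> [dge0 dsimplex] [A|[U i]] /=; first by rewrite lfunE => /eqP /dge0.
  move=> /andP[/eqP cU iU].
  by rewrite simplex_slackE subr_ge0; apply: dsimplex.
move=> Cd; split=> [A /eqP cA|U i /eqP cU iU].
  by have := Cd (inl A) cA; rewrite /= lfunE.
have /= := Cd (inr (U, i)); rewrite cU iU => /(_ isT).
by rewrite simplex_slackE subr_ge0.
Qed.

End HemiMetricCone.

(** * Partition hemi-metrics and their tight inequalities *)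

Section PartitionHemiMetric.
Variables (R : realType) (m n : nat) (S : {set {set 'I_n}}).
Hypothesis hS : finset.partition S [set: 'I_n].
Hypothesis hcard : #|S| = m.+1.
Implicit Types (A B U : {set 'I_n}).

Local Notation alpha := (@partition_hemimetric R m n S).
Local Notation tr := (transversal_set S).

Lemma heval_partition_hemimetric A : heval alpha A = (tr A)%:R.
Proof.
rewrite /heval; case: insubP => [u _ uA|].
  by rewrite ffunE uA /transversal_set; case: ifP.
by case: (boolP (tr A)) => // /(card_transversal_set hS) ->; rewrite hcard eqxx.
Qed.

(** Every facet [U :\ k] other than the two ends keeps both [x] and [y], hence
    is not a transversal, and [d] vanishes there: the right-hand side of the
    simplex inequality of [U] at [y] collapses to one term. *)
Lemma sum_facets_ends (d : hvec R m n) U B x y :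
    B \in S -> x \in B -> y \in B -> x != y -> x \in U -> y \in U ->
    (forall A, #|A| = m.+1 -> ~~ tr A -> heval d A = 0) ->
  #|U| = m.+2 -> \sum_(k in U :\ y) heval d (U :\ k) = heval d (U :\ x).
Proof.
move=> BS xB yB xy xU yU d0 cU.
rewrite (bigD1 x) /=; last by rewrite !inE xy xU.
rewrite big1 ?addr0 // => k; rewrite !inE => /andP[/andP[ky kU] kx].
apply: d0; first by move: (cardsD1 k U); rewrite kU cU => -[].
apply/negP => /(transversal_facet_ends BS xB yB xy xU yU).
by rewrite (negPf kx) (negPf ky).
Qed.

Lemma partition_hemimetric_off A : ~~ tr A -> heval alpha A = 0.
Proof. by rewrite heval_partition_hemimetric => /negPf ->. Qed.

Lemma partition_hemimetric_in_HMET : @HMET R m n alpha.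
Proof.
split=> [A _|U i cU iU]; first by rewrite heval_partition_hemimetric ler0n.
case: (boolP (tr (U :\ i))) => [trUi|/partition_hemimetric_off ->]; last first.
  by apply: sumr_ge0 => k _; rewrite heval_partition_hemimetric ler0n.
have [B BS iB] := part_of hS i.
have [x] := transversal_pick trUi BS; rewrite !inE => /andP[xi xU] xB.
rewrite (sum_facets_ends BS xB iB xi xU iU _ cU); last first.
  by move=> A _; apply: partition_hemimetric_off.
(* the facet opposite to [x] is the exchange of [x] for [i] in [U :\ i] *)
have := transversal_exchange hS trUi BS _ xB iB.
rewrite !inE xi xU => /(_ isT).
have -> : i |: U :\ i :\ x = U :\ x.
  apply/setP => z; rewrite !inE.
  by have [->|_] := eqVneq z i; rewrite // eq_sym xi iU.
by rewrite !heval_partition_hemimetric trUi => ->.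
Qed.

Lemma partition_hemimetric_neq0 : alpha != 0.
Proof.
have [A trA] := transversal_set_exists hS.
apply/eqP => alpha0; have := heval_partition_hemimetric A.
rewrite trA alpha0 /heval; case: insubP => [u _ _|_] /esym/eqP;
  by rewrite ?ffunE oner_eq0.
Qed.

(** Both [alpha] and [d] vanish off the transversals, so for either of them the
    slack of the simplex [y |: A] at [y] is the difference of the two values
    compared here; it is [1 - 1] for [alpha], so the inequality is tight. *)
Lemma tight_exchange (d : hvec R m n) :
    (forall A, #|A| = m.+1 -> ~~ tr A -> heval d A = 0) ->
    (forall U i, #|U| = m.+2 -> i \in U ->
       simplex_slack R m U i alpha = 0 -> simplex_slack R m U i d = 0) ->
  forall A B x y, tr A -> B \in S -> x \in A -> x \in B -> y \in B ->
    x != y -> heval d A = heval d (y |: A :\ x).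
Proof.
move=> d0 dtight A B x y trA BS xA xB yB xy.
have yA : y \notin A.
  by apply: contra xy => yA; rewrite (transversal_uniq trA BS xA xB yA yB).
have cU : #|y |: A| = m.+2.
  by rewrite cardsU1 yA (card_transversal_set hS trA) hcard.
have Uy : (y |: A) :\ y = A by rewrite setU1K.
have Ux : (y |: A) :\ x = y |: A :\ x.
  by apply/setP => z; rewrite !inE; case: (eqVneq z y) => // ->; rewrite eq_sym xy.
have xU : x \in y |: A by rewrite !inE xA orbT.
have yU : y \in y |: A by rewrite setU11.
have slackE e : (forall A', #|A'| = m.+1 -> ~~ tr A' -> heval e A' = 0) ->
    simplex_slack R m (y |: A) y e = heval e (y |: A :\ x) - heval e A :> R.
  move=> e0; rewrite simplex_slackE.
  by rewrite (sum_facets_ends BS xB yB xy xU yU e0 cU) Uy Ux.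
have := dtight _ _ cU yU; rewrite !slackE //; last first.
  by move=> A' _; apply: partition_hemimetric_off.
rewrite !heval_partition_hemimetric trA (transversal_exchange hS trA BS xA xB yB).
by rewrite subrr => /(_ erefl) /eqP; rewrite subr_eq0 => /eqP.
Qed.

End PartitionHemiMetric.

Theorem theorem4 (R : realType) (m n : nat) (hm : (1 <= m)%N)
    (hn : (m + 3 <= n)%N) (S : {set {set 'I_n}})
    (hS : finset.partition S [set: 'I_n]%SET) (hcard : #|S| = m.+1) :
  generates_extreme_ray (@HMET R m n) (@partition_hemimetric R m n S).
Proof.
have alphaC := partition_hemimetric_in_HMET R hS hcard.
have alpha0 := partition_hemimetric_neq0 R hS hcard.
move: alphaC; rewrite HMET_polyhedral => alphaC.
apply: polyhedral_extreme_ray => // d Cd tight.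
have d0 (A : {set 'I_n}) : #|A| = m.+1 -> ~~ transversal_set S A -> heval d A = 0.
  move=> /eqP cA ntrA; have := tight (inl A) cA; rewrite /= !lfunE; apply.
  exact: (partition_hemimetric_off R hS hcard ntrA).
have dtight (U : {set 'I_n}) i : #|U| = m.+2 -> i \in U ->
    simplex_slack R m U i (partition_hemimetric R m S) = 0 ->
    simplex_slack R m U i d = 0.
  by move=> /eqP cU iU; apply: (tight (inr (U, i))); rewrite /= cU.
have dconst := transversal_connect hS (tight_exchange hS hcard d0 dtight).
have [A0 trA0] := transversal_set_exists hS.
exists (heval d A0).
  move: Cd; rewrite -HMET_polyhedral => -[dge0 _]; apply: dge0.
  by rewrite (card_transversal_set hS trA0).
apply/ffunP => u; rewrite !ffunE.
rewrite -(heval_val d) -/(transversal_set S (val u)).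
case: ifP => [tru|/negbT ntru]; first by rewrite (dconst _ A0) // [RHS]mulr1.
by rewrite d0 ?scaler0 //; apply/eqP; apply: (valP u).
Qed.
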